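(* Let $p$ be an odd prime and $r$ a positive integer with $p^r\ge5$. Let $\alpha$ be a generator of $\mathbb{F}_{p^{2r}}^*$ and let $C^H=\{C^H_0,C^H_1,\dots,C^H_{2p^r+1}\}$, where $C^H_i=\{\alpha^t : t\equiv i\pmod{2(p^r+1)}\}$, which is a $\left(p^{2r}, \frac{p^r-1}{2}, \frac{p^r-3}{2}\right)$ difference family in the additive group of $\mathbb{F}_{p^{2r}}$. The associated $2$-$\left(p^{2r}, \frac{p^r-1}{2}, \frac{p^r-3}{2}\right)$ design $dev(C^H)$ has exactly the following block intersection numbers with the following multiplicities (where, if two of the listed numbers coincide, the multiplicity of that number is the sum of the listed multiplicities). If $p^r-1 \equiv 0 \pmod 4$, then \[ \begin{array}{ll} \text{block intersection number} & \text{multiplicity}\\ 0 & \frac{1}{2}\left(3p^{6r} + 9p^{5r} + p^{4r} - 3p^{3r} + 2p^{2r}\right)\\ 1 & \frac{1}{2}\left(p^{6r} - p^{5r} - p^{4r} + p^{3r}\right)\\ \frac{1}{4}(p^r-5) & \frac{1}{2}\left(p^{4r}-p^{2r}\right)\\ \frac{1}{4}(p^r-1) & \frac{1}{2}\left(3p^{4r}-3p^{2r}\right) \end{array} \] If $p^r-1 \equiv 2 \pmod 4$, then \[ \begin{array}{ll} \text{block intersection number} & \text{multiplicity}\\ 0 & \frac{1}{2}\left(3p^{6r} + 9p^{5r} + p^{4r} - 3p^{3r} + 2p^{2r}\right)\\ 1 & \frac{1}{2}\left(p^{6r} - p^{5r} - p^{4r} + p^{3r}\right)\\ \frac{1}{4}(p^r-3)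 & \frac{1}{2}\left(3p^{4r}-3p^{2r}\right)\\ \frac{1}{4}(p^r+1) & \frac{1}{2}\left(p^{4r}-p^{2r}\right) \end{array} \]
   Context: The development of $C^H$ is the collection $dev(C^H)=\{C^H_i+g : 0\le i\le 2p^r+1,\ g\in\mathbb{F}_{p^{2r}}\}$ of all translates; its members are the blocks of the design with point set $\mathbb{F}_{p^{2r}}$. An integer $N$ is a block intersection number of a design if the design contains two distinct blocks $B,B'$ with $|B\cap B'|=N$; the multiplicity of $N$ is the number of unordered pairs of distinct blocks meeting in exactly $N$ points. *)

(* Defs.v *)
From HB Require Import structures.
From mathcomp Require Import all_boot all_order all_algebra all_fingroup all_solvable.

Set Implicit Arguments.
Unset Strict Implicit.
Unset Printing Implicit Defensive.

Import GRing.Theory Num.Theory.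
Local Open Scope ring_scope.

(* The exponent t is taken below the order of alpha so that the set is finite
   by construction; cyclotomic_classP shows that all integers t are covered. *)
Definition cyclotomic_class (F : finFieldType) (alpha : {unit F}) (e i : nat) :
    {set F} :=
  [set FinRing.uval alpha ^+ t | t : 'I_(#[alpha]%g) & (t == i %[mod e])%N].

Lemma cyclotomic_classP (F : finFieldType) (alpha : {unit F}) (e i : nat)
    (x : F) :
  (e %| #[alpha]%g)%N ->
  reflect (exists2 t : int, (t = i%:Z %[mod e%:Z])%Z
                          & x = FinRing.uval alpha ^ t)
          (x \in cyclotomic_class alpha e i).
Proof.
set a := FinRing.uval alpha => dvd_e.
have aU : a \is a GRing.unit by rewrite /a; case: (alpha).
have aX : a ^+ #[alpha]%g = 1 by rewrite -FinRing.val_unitX expg_order.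
apply: (iffP imsetP) => [[t]|[t tE ->]].
  rewrite inE => /eqP tE ->; exists (nat_of_ord t)%:Z => //.
  by rewrite !modz_nat tE.
have o_gt0 : 0 < (#[alpha]%g)%:Z by rewrite ltz_nat order_gt0.
have [n nE] : exists n : nat, (t %% (#[alpha]%g)%:Z)%Z = n%:Z.
  by exists `|(t %% (#[alpha]%g)%:Z)%Z|%N; rewrite gez0_abs // modz_ge0 // lt0r_neq0.
have n_lt : (n < #[alpha]%g)%N by rewrite -ltz_nat -nE ltz_pmod.
have tn : t = (t %/ (#[alpha]%g)%:Z)%Z * (#[alpha]%g)%:Z + n%:Z.
  by rewrite -nE -divz_eq.
exists (Ordinal n_lt).
  rewrite inE /= -eqz_nat -!modz_nat -tE tn.
  by case/dvdnP: dvd_e => k ->; rewrite PoszM mulrA modzMDl.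
rewrite -/a /= tn expfzDr -?unitfE // mulrC.
by rewrite [_ * (#[alpha]%g)%:Z]mulrC -exprz_exp -(exprnP a #[alpha]%g) aX exp1rz mulr1.
Qed.

Definition CH (p r : nat) (F : finFieldType) (alpha : {unit F})
    (i : 'I_(2 * p ^ r + 1).+1) : {set F} :=
  cyclotomic_class alpha (2 * (p ^ r + 1)) i.

Definition difference_family (V : finZmodType) (I : finType)
    (B : I -> {set V}) (v k lambda : nat) : Prop :=
  [/\ #|V| = v,
      forall i, #|B i| = k
    & forall d : V, d != 0 ->
        (\sum_i #|[set xy in setX (B i) (B i) | (xy.1 - xy.2)%R == d]|)%N
          = lambda].

Definition dev (V : finZmodType) (I : finType) (B : I -> {set V}) :
    {set {set V}} :=
  [set [set x + g | x in B i] | i : I, g : V].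

Definition two_design (T : finType) (D : {set {set T}}) (v k lambda : nat) :
    Prop :=
  [/\ #|T| = v,
      forall B, B \in D -> #|B| = k
    & forall x y : T, x != y ->
        #|[set B in D | (x \in B) && (y \in B)]| = lambda].

Definition block_intersection_number (T : finType) (D : {set {set T}})
    (N : nat) : Prop :=
  exists B B' : {set T}, [/\ B \in D, B' \in D, B != B' & #|B :&: B'| = N].

Definition multiplicity (T : finType) (D : {set {set T}}) (N : nat) : nat :=
  #|[set P : {set {set T}} |
      [exists B in D, exists B' in D,
        [&& B != B', P == [set B; B'] & #|B :&: B'| == N]]]|.

(* A table is a list of rows (number, multiplicity), valued in rat so that
   fractions and differences are not truncated; rows whose numbers coincide
   have their multiplicities added. *)
Definition has_intersection_table (T : finType) (D : {set {set T}})
    (tab : seq (rat * rat)) : Prop :=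
  (forall a : rat, a \in [seq row.1 | row <- tab] <->
     exists2 N : nat, a = N%:R & block_intersection_number D N) /\
  (forall N : nat, block_intersection_number D N ->
     (multiplicity D N)%:R = \sum_(row <- tab | row.1 == N%:R) row.2).

(* Main.v *)
Require Import Defs.
From HB Require Import structures.
From mathcomp Require Import all_boot all_order all_algebra all_fingroup all_solvable.
From mathcomp Require Import finfield zify ring.

Set Implicit Arguments.
Unset Strict Implicit.
Unset Printing Implicit Defensive.

Import GRing.Theory Num.Theory.
Local Open Scope ring_scope.

(** Write q = p^r = 2k + 1 and let K be the subfield of order q, i.e. the set
    of x with x^q = x. Its nonzero elements are the squares S, where x^k = 1,
    and the nonsquares N, where x^k = -1. The classes C^H_i are exactly the
    cosets cS with c nonzero, hence the level sets of x |-> x^k away from 0, and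
    the blocks are the translates cS + h; this is [dev_block].

    Affine maps permute the blocks transitively, so it suffices to intersect S
    with every block cS + h. If c is outside K, then s - c s' determines the
    pair (s, s'), so S meets cS + h in one point for k^2 values of h and in none
    for the others. If c is in K, then S and cS lie on the line K: the meet is
    empty for h outside K, and for h in K it depends only on the quadratic
    characters of c and h. It is therefore one of four cyclotomic numbers of
    order 2, which three counting relations determine ([meet_values]):
    partitioning S by the character of x - h; summing |S :&: (S + h)| over all
    h; and a symmetry under h |-> - h, which relates two of the four numbers,
    the pair depending on the parity of k. For k even the values are
    k/2 - 1 = (q - 5)/4 once and k/2 = (q - 1)/4 three times; for k odd,
    (k - 1)/2 = (q - 3)/4 three times and (k + 1)/2 = (q + 1)/4 once.

    None of these numbers reaches k unless c is in S and h = 0. Hence the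
    blocks cS + h and c'S + h' are distinct unless h = h' and cS = c'S, every
    block comes from exactly k parameters (c, h), and counting blocks amounts
    to counting parameters ([sum_blocks]). Weighting the values above by the
    number of parameters that give them yields the multiplicities
    ([multiplicity_blocks]).

    The two design properties rest on one count: for d nonzero, u + d and u
    have the same nonzero k-th power exactly when u = d / (s - 1) with s in S
    and s != 1, which leaves k - 1 = (q - 3)/2 choices ([card_ratio_class]). *)

(** * Unordered pairs of blocks *)

Section PairsOfBlocks.

Variables (T : finType) (D : {set {set T}}) (N : nat).

Lemma double_multiplicity :
  (2 * multiplicity D N =
   \sum_(B in D) \sum_(B' in D) ((B != B') && (#|B :&: B'| == N)))%N.
Proof.
pose O := [set u : {set T} * {set T} |
  [&& u.1 \in D, u.2 \in D, u.1 != u.2 & #|u.1 :&: u.2| == N]].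
have -> : (\sum_(B in D) \sum_(B' in D) ((B != B') && (#|B :&: B'| == N)) = #|O|)%N.
  rewrite pair_big /= -sum1dep_card [RHS]big_mkcond /= [LHS]big_mkcond /=.
  by apply: eq_bigr => -[B B'] _ /=; rewrite andbA; do 2!case: ifP => //= ->.
pose f (u : {set T} * {set T}) := [set u.1; u.2].
rewrite /multiplicity; set M := [set P | _].
have fM u : u \in O -> f u \in M.
  case: u => B B'; rewrite !inE /= => /and4P[BD B'D ne cN].
  apply/existsP; exists B; rewrite BD; apply/existsP; exists B'.
  by rewrite B'D ne cN eqxx.
(* forgetting the order is two-to-one on pairs of distinct blocks *)
rewrite -[RHS]sum1_card (partition_big f (fun P => P \in M)) //=.
rewrite mulnC -sum_nat_const; apply: eq_bigr => P.
rewrite inE => /existsP[B /andP[BD /existsP[B' /and4P[B'D ne /eqP-> cN]]]].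
rewrite sum1dep_card -(_ : #|[set (B, B'); (B', B)]| = 2)%N; last first.
  by rewrite cards2 xpair_eqE negb_and ne.
apply: eq_card => -[X Y]; rewrite !inE !xpair_eqE /=; apply/orP/andP.
  by case=> /andP[/eqP-> /eqP->]; rewrite BD B'D /f /= 1?setUC ?ne ?eqxx // eq_sym ne setIC.
case=> /and4P[_ _ neXY _] /eqP eP.
have : X \in [set B; B'] by rewrite -eP !inE eqxx.
have : Y \in [set B; B'] by rewrite -eP !inE eqxx orbT.
rewrite !inE => /orP[]/eqP eY /orP[]/eqP eX; move: neXY.
all: by rewrite eX eY ?eqxx //; auto.
Qed.

Lemma block_intersection_numberE :
  block_intersection_number D N <-> (0 < multiplicity D N)%N.
Proof.
split=> [[B [B' [BD B'D ne cN]]]|].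
  apply/card_gt0P; exists [set B; B']; rewrite inE.
  apply/existsP; exists B; rewrite BD; apply/existsP; exists B'.
  by rewrite B'D ne cN !eqxx.
case/card_gt0P=> P.
rewrite inE => /existsP[B /andP[BD /existsP[B' /and4P[B'D ne _ /eqP cN]]]].
by exists B, B'.
Qed.

End PairsOfBlocks.

(** * Cosets of the roots of unity as level sets of a power map *)

Section PowerClasses.

Variables (F : finFieldType) (k : nat).

(** The translate by [h] of the coset of [c] modulo the k-th roots of unity.
    As a level set it needs no choice of representatives: membership is an
    equation between powers. *)
Definition block (c h : F) : {set F} := [set x | (x - h) ^+ k == c ^+ k].

Definition blocks : {set {set F}} :=
  [set block u.1 u.2 | u in [set u : F * F | u.1 != 0]].

(** For [u] and [v] in {1, -1} and [h] nonzero in the subfield, these are the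
    cyclotomic numbers of order 2 of the subfield. *)
Definition meet (u v h : F) : nat :=
  #|[set x | (x ^+ k == u) && ((x - h) ^+ k == v)]|.

Lemma card_block_meet c h c' h' :
  #|block c h :&: block c' h'| = meet (c ^+ k) (c' ^+ k) (h' - h).
Proof.
rewrite -(card_imset _ (@addIr F (- h))).
apply: eq_card => x; rewrite !inE; apply/imsetP/idP => [[y]|].
  by rewrite !inE => yB ->; rewrite opprB addrA subrK.
move=> xB; exists (x + h); last by rewrite addrK.
by rewrite !inE addrK; move: xB; rewrite opprB addrA.
Qed.

Lemma meet_scale a u v h :
  a != 0 -> meet u v h = meet (a ^+ k * u) (a ^+ k * v) (a * h).
Proof.
move=> a0; have aU : a \is a GRing.unit by rewrite unitfE.
rewrite /meet -(card_imset _ (mulfI a0)).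
apply: eq_card => x; rewrite !inE; apply/imsetP/idP => [[y]|].
  by rewrite inE => /andP[/eqP<- /eqP<-] ->; rewrite -mulrBr !exprMn !eqxx.
have [y ->] : exists y, x = a * y by exists (x / a); rewrite mulrC divfK.
rewrite -mulrBr !exprMn !(inj_eq (mulfI _)) ?expf_neq0 // => yP.
by exists y; rewrite ?inE.
Qed.

Lemma meet_opp u v h : meet u v h = meet v u (- h).
Proof.
rewrite /meet -(card_imset _ (@addIr F (- h))).
apply: eq_card => x; rewrite !inE; apply/imsetP/idP => [[y]|].
  by rewrite inE => /andP[/eqP<- /eqP<-] ->; rewrite opprK subrK !eqxx.
move=> xB; exists (x + h); last by rewrite addrK.
by rewrite inE addrK andbC; move: xB; rewrite opprK.
Qed.

Lemma sum_meet u v :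
  (\sum_h meet u v h = #|[set x | x ^+ k == u]| * #|[set x | x ^+ k == v]|)%N.
Proof.
pose P x y := (x ^+ k == u) && ((y : F) ^+ k == v).
rewrite -cardsX -sum1_card.
transitivity (\sum_h \sum_x (P x (x - h)%R))%N.
  by apply: eq_bigr => h _; rewrite /meet -sum1dep_card big_mkcond.
transitivity (\sum_x \sum_y (P x y))%N.
  rewrite exchange_big /=; apply: eq_bigr => x _.
  rewrite (reindex_inj (inv_inj (subKr x))).
  by apply: eq_bigr => y _; rewrite subKr.
rewrite pair_big big_mkcond [RHS]big_mkcond; apply: eq_bigr => -[x y] _.
by rewrite !inE.
Qed.

Hypothesis k_ge2 : (2 <= k)%N.
Let q := k.*2.+1.
Hypothesis cardF : #|F| = (q ^ 2)%N.
Variable z : F.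
Hypothesis prim_z : ((2 * (q + 1)) * k)%N.-primitive_root z.
Hypothesis qsub : forall x y : F, (x - y) ^+ q = x ^+ q - y ^+ q.

Let k_gt0 : (0 < k)%N. Proof. exact: leq_trans k_ge2. Qed.

Lemma expk_eq0 (x : F) : (x ^+ k == 0) = (x == 0).
Proof. by rewrite expf_eq0 k_gt0. Qed.

Lemma card_unity_class : #|[set x : F | x ^+ k == 1]| = k.
Proof.
have /dvdn_prim_root : (k %| 2 * (q + 1) * k)%N by rewrite dvdn_mull.
move/(_ _ _ prim_z); set y := z ^+ _ => prim_y.
have injy : injective (fun i : 'I_k => y ^+ i).
  move=> i j /eqP; rewrite (eq_prim_root_expr prim_y) !modn_small // => /eqP.
  exact: val_inj.
rewrite -[RHS]card_ord -(card_imset _ injy).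
apply: eq_card => x; rewrite !inE; apply/eqP/imsetP => [|[i _ ->]].
  by case/(prim_rootP prim_y) => i ->; exists i.
by rewrite exprAC (prim_expr_order prim_y) expr1n.
Qed.

Lemma card_power_class c : c != 0 -> #|[set x : F | x ^+ k == c ^+ k]| = k.
Proof.
move=> c0; rewrite -[RHS]card_unity_class -(card_imset [set x | x ^+ k == 1] (mulfI c0)).
apply: eq_card => x; rewrite !inE; apply/idP/imsetP => [/eqP xP|[y]].
  exists (x / c); last by rewrite mulrC divfK.
  by rewrite inE expr_div_n xP divff ?expk_eq0.
by rewrite inE => /eqP y1 ->; rewrite exprMn y1 mulr1.
Qed.

(** For a primitive element [z], the power [z ^+ (q + 1)] generates the
    multiplicative group of the subfield, so it is a nonsquare there. *)
Lemma nonsquareP : exists2 w : F, w ^+ k = -1 & (1 : F) != -1.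
Proof.
pose y := z ^+ ((q + 1) * k).
have yN1 : y = -1.
  have : y ^+ 2 == 1.
    rewrite -exprM (_ : (_ * _ * 2)%N = (2 * (q + 1) * k)%N); last by lia.
    by rewrite (prim_expr_order prim_z).
  rewrite sqrf_eq1 => /orP[|/eqP //].
  by rewrite -(prim_order_dvd prim_z) => /dvdn_leq; nia.
exists (z ^+ (q + 1)); first by rewrite -exprM.
rewrite -yN1 eq_sym -(prim_order_dvd prim_z).
by apply/negP => /dvdn_leq; nia.
Qed.

(** Since q = 2k + 1, [x ^+ q = x] says that [x ^+ k] is a square root of 1. *)
Lemma subfieldE (x : F) : x != 0 ->
  (x ^+ q == x) = (x ^+ k == 1) || (x ^+ k == -1).
Proof.
move=> x0; rewrite -sqrf_eq1 -exprM muln2 exprS -{3}[x]mulr1.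
by rewrite (inj_eq (mulfI x0)).
Qed.

(** Zero, the squares and the nonsquares of the subfield, and the elements
    outside it: the summands it is applied to
    are constant on each of these four parts. *)
Lemma sum_by_class (f : F -> nat) :
  (\sum_h f h = f 0%R + \sum_(h : F | h ^+ k == 1%R) f h
     + \sum_(h : F | h ^+ k == (-1)%R) f h + \sum_(h : F | h ^+ q != h) f h)%N.
Proof.
have [w wk N1] := nonsquareP.
rewrite (bigD1 0) //= -!addnA; congr addn.
rewrite (bigID (fun h : F => h ^+ k == 1)) /=; congr addn.
  apply: eq_bigl => h; have [->|//] := eqVneq h 0.
  by rewrite /= expr0n eqn0Ngt k_gt0 eq_sym oner_eq0.
rewrite (bigID (fun h : F => h ^+ k == -1)) /=; congr addn.
  apply: eq_bigl => h; have [->|h0] := eqVneq h 0.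
    by rewrite /= expr0n eqn0Ngt k_gt0 eq_sym oppr_eq0 oner_eq0.
  by have [->|] := eqVneq (h ^+ k) (-1); rewrite ?andbF // eq_sym N1.
apply: eq_bigl => h; have [->|h0] := eqVneq h 0.
  by rewrite /= expr0n eqxx.
by rewrite subfieldE // negb_or.
Qed.

Lemma card_nonsquare : #|[set x : F | x ^+ k == -1]| = k.
Proof.
have [w wk _] := nonsquareP; rewrite -wk card_power_class //.
by rewrite -expk_eq0 wk oppr_eq0 oner_eq0.
Qed.

Lemma card_outside_subfield : (#|[set h : F | h ^+ q != h]| + q = q ^ 2)%N.
Proof.
rewrite -cardF -[#|F|]sum1_card sum_by_class !sum1dep_card card_unity_class card_nonsquare.
by rewrite addnC; congr addn; rewrite /q; lia.
Qed.

(** * Intersection numbers with the block of k-th roots of unity *)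

Lemma unity_in_subfield (x u : F) : u ^+ 2 = 1 -> x ^+ k = u -> x ^+ q = x.
Proof. by move=> u1 xk; rewrite exprS -muln2 exprM xk u1 mulr1. Qed.

(** Two common points [x] and [y] have a difference in the subfield, and the
    same difference divided by [c] is also in the subfield; as [c] is not,
    [x = y]. *)
Lemma meet_outside_le1 c h : c ^+ q != c -> (meet 1%R (c ^+ k) h <= 1)%N.
Proof.
move=> cK; have c0 : c != 0 by apply: contraNneq cK => ->; rewrite expr0n.
have S_K := unity_in_subfield (expr1n F 2).
apply/card_le1_eqP => y x; rewrite !inE => /andP[/eqP y1 /eqP yh] /andP[/eqP x1 /eqP xh].
apply/eqP; rewrite -subr_eq0; apply: contraNT cK => d0.
have dK : (x - y) ^+ q = x - y by rewrite qsub !S_K.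
have quotK a : (a - h) ^+ k = c ^+ k -> ((a - h) / c) ^+ q = (a - h) / c.
  by move=> ah; rewrite S_K // expr_div_n ah divff ?expk_eq0.
have eE : (x - h) / c - (y - h) / c = (x - y) / c by field.
have eK : ((x - y) / c) ^+ q = (x - y) / c by rewrite -eE qsub !quotK.
have -> : c = (x - y) / ((x - y) / c) by field; rewrite c0 d0.
by rewrite expr_div_n dK eK.
Qed.

(** The meets are 0 or 1, so the number of ones is their sum over all
    translations, which [sum_meet] evaluates. *)
Lemma count_outside c N : c ^+ q != c ->
  (#|[set h | meet 1%R (c ^+ k) h == N]| =
   (N == 1) * k ^ 2 + (N == 0) * (q ^ 2 - k ^ 2))%N.
Proof.
move=> cK; have c0 : c != 0 by apply: contraNneq cK => ->; rewrite expr0n.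
have le1 h := meet_outside_le1 h cK.
have one : (#|[set h | meet 1%R (c ^+ k) h == 1]| = k ^ 2)%N.
  have := sum_meet 1 (c ^+ k); rewrite card_unity_class card_power_class // mulnn.
  move=> <-; rewrite -sum1dep_card big_mkcond; apply: eq_bigr => h _.
  by case: (meet _ _ _) (le1 h) => [|[]].
case: N => [|[|N]] /=.
- rewrite mul0n mul1n add0n -cardF -one -(cardsC [set h | meet 1 (c ^+ k) h == 1%N]) addKn.
  by apply: eq_card => h; rewrite !inE; case: (meet _ _ _) (le1 h) => [|[]].
- by rewrite one !mul1n mul0n addn0.
rewrite !mul0n; apply/eqP; rewrite cards_eq0; apply/eqP/setP => h; rewrite !inE.
by case: (meet _ _ _) (le1 h) => [|[]].
Qed.

Lemma meet_outside_line u v h : u ^+ 2 = 1 -> v ^+ 2 = 1 -> h ^+ q != h ->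
  meet u v h = 0%N.
Proof.
move=> u1 v1 hK; apply/eqP; rewrite cards_eq0; apply/eqP/setP => x; rewrite !inE.
apply: contraNF hK => /andP[/eqP xu /eqP xv].
have -> : h = x - (x - h) by rewrite subKr.
by rewrite qsub (unity_in_subfield u1 xu) (unity_in_subfield v1 xv).
Qed.

(** Scaling by [h' / h], whose k-th power is 1, preserves both level sets. *)
Lemma meet_same_class u v (h h' : F) : h != 0 -> h ^+ k = h' ^+ k ->
  meet u v h = meet u v h'.
Proof.
move=> h0 hh; have h'0 : h' != 0 by rewrite -expk_eq0 -hh expk_eq0.
rewrite (@meet_scale (h' / h)) ?mulf_neq0 ?invr_eq0 //.
by rewrite expr_div_n hh divff ?expk_eq0 // !mul1r divfK.
Qed.

(** For [x] a square, [x - h] is a square, a nonsquare or zero; the last case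
    occurs exactly when [h] itself is a square. *)
Lemma meet_split (h : F) : h != 0 -> h ^+ q = h ->
  (meet 1%R 1%R h + meet 1%R (-1)%R h + (h ^+ k == 1%R) = k)%N.
Proof.
move=> h0 hK; have [w wk N1] := nonsquareP.
have S_K := unity_in_subfield (expr1n F 2).
rewrite -[RHS]card_unity_class /meet -!sum1dep_card.
rewrite [RHS](bigID (fun x => (x - h) ^+ k == 1)) /= -addnA; congr addn.
rewrite [RHS](bigID (fun x => (x - h) ^+ k == -1)) /=; congr addn.
  apply: eq_bigl => x; rewrite -andbA; congr andb.
  by have [->|] := eqVneq ((x - h) ^+ k) (-1); rewrite ?andbF // eq_sym N1.
rewrite sum1dep_card; case: eqP => hk /=; apply/esym/eqP.
  apply/cards1P; exists h; apply/setP => x; rewrite !inE.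
  have [->|xh] := eqVneq x h.
    rewrite hk subrr expr0n eqn0Ngt k_gt0 /= eqxx ![0 == _]eq_sym.
    by rewrite oppr_eq0 oner_eq0.
  rewrite -andbA -negb_or; apply/negP => /andP[/eqP x1].
  by rewrite -subfieldE ?subr_eq0 // qsub hK S_K ?eqxx.
rewrite cards_eq0; apply/eqP/setP => x; rewrite !inE.
apply/negP; rewrite -andbA -negb_or => /andP[/eqP x1].
have xh : x != h by apply/eqP => xh; apply: hk; rewrite -xh.
by rewrite -subfieldE ?subr_eq0 // qsub hK S_K ?eqxx.
Qed.

(** The cyclotomic numbers of order 2. [S1] and [Sw] partition the squares by
    the character of [x - h], [sum11] counts the pairs of squares by their
    difference, and [par] comes from [meet_opp]. If -1 is a nonsquare, i.e. k is
    odd, negating [h] moves it to the other class. If -1 is a square, negation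
    only exchanges the two level sets, and scaling by a nonsquare exchanges them
    back while moving [h] to the other class. Halving upwards and downwards
    treats both parities at once. *)
Lemma meet_values (h : F) :
  [/\ h ^+ k = 1 -> meet 1 1 h = k.-1./2,
      h ^+ k = -1 -> meet 1 1 h = k./2,
      h ^+ k = 1 -> meet 1 (-1) h = k./2
    & h ^+ k = -1 -> meet 1 (-1) h = uphalf k].
Proof.
have [w wk N1] := nonsquareP.
have w0 : w != 0 by rewrite -expk_eq0 wk oppr_eq0 oner_eq0.
have n1 : (1 : F) != 0 := oner_neq0 F.
have hn u : u ^+ 2 = 1 -> h ^+ k = u -> h != 0.
  by move=> u1 hu; rewrite -expk_eq0 hu -[_ == 0](expf_eq0 _ 2) u1.
have sqN : (-1 : F) ^+ 2 = 1 by rewrite sqrrN expr1n.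
have sq1 := expr1n F 2.
have S1 := meet_split n1 (expr1n F q); rewrite expr1n eqxx in S1.
have Sw := meet_split w0 (unity_in_subfield sqN wk).
rewrite wk eq_sym (negPf N1) addn0 in Sw.
have sum11 : (k + k * meet 1%R 1%R 1%R + k * meet 1%R 1%R w = k * k)%N.
  have := sum_meet 1 1; rewrite card_unity_class => <-.
  rewrite sum_by_class [X in (_ = _ + X)%N]big1 => [|x xK]; last by rewrite meet_outside_line.
  rewrite addn0; congr (_ + _ + _)%N.
  - rewrite -[LHS]card_unity_class; apply: eq_card => x.
    by rewrite !inE subr0 andbb.
  - rewrite (eq_bigr (fun _ => meet 1 1 1%R)) => [|x /eqP x1]; last first.
      by apply: meet_same_class; rewrite ?expr1n // -expk_eq0 x1.
    by rewrite -{1}card_unity_class -sum_nat_const; apply: eq_bigl => x; rewrite inE.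
  - rewrite (eq_bigr (fun _ => meet 1 1 w)) => [|x /eqP x1]; last first.
      by apply: meet_same_class; rewrite ?wk // -expk_eq0 x1 oppr_eq0.
    by rewrite -{1}card_nonsquare -sum_nat_const; apply: eq_bigl => x; rewrite inE.
have par : if odd k then meet 1 1 w = meet 1 1 1 else meet 1 (-1) w = meet 1 (-1) 1.
  case: ifP => k_odd.
    rewrite [RHS]meet_opp; apply: meet_same_class => //.
    by rewrite wk -signr_odd k_odd.
  rewrite [RHS]meet_opp [RHS](@meet_scale (- w)) ?oppr_eq0 //.
  by rewrite exprNn wk -signr_odd k_odd expr0 !mul1r !mulrN1 !opprK ?mulr1.
have v : [/\ meet 1 1 1 = k.-1./2, meet 1 1 w = k./2,
            meet 1 (-1) 1 = k./2 & meet 1 (-1) w = uphalf k].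
  have v12 : (meet 1%R 1%R 1%R + meet 1%R 1%R w = k.-1)%N.
    by apply/eqP; rewrite -(eqn_pmul2l k_gt0) mulnDr; lia.
  by move: par; case: ifP => k_odd par; split; lia.
have [v1 v2 v3 v4] := v.
split=> hk.
- by rewrite -v1; apply: meet_same_class; rewrite ?expr1n // (hn 1).
- by rewrite -v2; apply: meet_same_class; rewrite ?wk // (hn (-1)).
- by rewrite -v3; apply: meet_same_class; rewrite ?expr1n // (hn 1).
by rewrite -v4; apply: meet_same_class; rewrite ?wk // (hn (-1)).
Qed.
Lemma meet_distinct u v : u != v -> meet u v 0 = 0%N.
Proof.
move=> uv; apply/eqP; rewrite cards_eq0; apply/eqP/setP => x; rewrite !inE subr0.
by apply/negP => /andP[/eqP-> /idPn]; rewrite uv.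
Qed.

(** This is what tells blocks apart: two equal blocks meet in k points. *)
Lemma meet_lt c h : c != 0 -> ~~ ((c ^+ k == 1) && (h == 0)) -> (meet 1%R (c ^+ k) h < k)%N.
Proof.
move=> c0; have [w wk N1] := nonsquareP; have sq1 := expr1n F 2.
have sqN : (-1 : F) ^+ 2 = 1 by rewrite sqrrN expr1n.
have [v1 v2 v3 v4] := meet_values h.
have [cK|cK] := eqVneq (c ^+ q) c; last first.
  by move=> _; apply: leq_ltn_trans (meet_outside_le1 h cK) k_ge2.
move: (subfieldE c0); rewrite cK eqxx => /esym/orP[]/eqP ->; rewrite ?eqxx /=.
  move=> h0; have [hK|hK] := eqVneq (h ^+ q) h; last by rewrite meet_outside_line.
  move: (subfieldE h0); rewrite hK eqxx => /esym/orP[/eqP/v1->|/eqP/v2->]; lia.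
move=> _; have [->|h0] := eqVneq h 0; first by rewrite meet_distinct.
have [hK|hK] := eqVneq (h ^+ q) h; last by rewrite meet_outside_line.
move: (subfieldE h0); rewrite hK eqxx => /esym/orP[/eqP/v3->|/eqP/v4->]; lia.
Qed.

Lemma card_block_meet_scaled c h c' h' : c != 0 ->
  #|block c h :&: block c' h'| = meet 1 ((c' / c) ^+ k) ((h' - h) / c).
Proof.
move=> c0; rewrite card_block_meet (@meet_scale c^-1) ?invr_eq0 //.
by rewrite -!exprMn mulVf // expr1n !(mulrC c^-1).
Qed.

Lemma card_block c h : c != 0 -> #|block c h| = k.
Proof.
move=> c0; rewrite -[RHS](card_power_class c0) -(card_imset _ (@addIr F (- h))).
apply: eq_card => x; rewrite !inE; apply/imsetP/idP => [[y]|].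
  by rewrite inE => yB ->.
by move=> xB; exists (x + h); rewrite ?inE addrK.
Qed.

Lemma block_eq c h c' h' : c != 0 -> c' != 0 ->
  (block c h == block c' h') = (c ^+ k == c' ^+ k) && (h == h').
Proof.
move=> c0 c'0; apply/eqP/andP => [e|[/eqP e /eqP->]]; last first.
  by apply/setP => x; rewrite !inE e.
have := card_block_meet_scaled h c' h' c0; rewrite -e setIid card_block //.
have := @meet_lt (c' / c) ((h' - h) / c); rewrite mulf_neq0 ?invr_eq0 // => /(_ isT).
case: andP => [[e1 e2] _ _|_ /(_ isT)].
  split; last first.
    by move: e2; rewrite mulf_eq0 invr_eq0 (negPf c0) orbF subr_eq0 eq_sym.
  by move: e1; rewrite expr_div_n; move/eqP/divr1_eq => ->.
by move=> lt e3; rewrite -e3 ltnn in lt.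
Qed.

(** * Counting blocks through their parameters *)

(** The block of [(c, h)] determines [h] and the power [c ^+ k], hence [c] up
    to one of the k roots of unity. *)
Lemma sum_blocks (f : {set F} -> nat) :
  (k * \sum_(B in blocks) f B = \sum_(c : F | c != 0%R) \sum_h f (block c h))%N.
Proof.
rewrite pair_big /= (partition_big (fun u => block u.1 u.2) (fun B => B \in blocks)) /=.
  rewrite big_distrr /=; apply: eq_bigr => B /imsetP[[c h]].
  rewrite inE /= => c0 ->.
  rewrite (eq_bigr (fun _ => f (block c h))) => [|u /andP[_ /eqP-> //]].
  rewrite sum_nat_cond_const; congr muln.
  rewrite -(card_power_class c0) -(card_imset _ (_ : injective (fun x => (x, h)))); last first.
    by move=> x y [].
  apply: eq_card => -[x y]; rewrite !inE /= andbT; apply/imsetP/andP => [[t]|[x0]].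
    rewrite inE => /eqP tP [-> ->].
    have t0 : t != 0 by rewrite -expk_eq0 tP expk_eq0.
    by rewrite t0 block_eq // tP !eqxx.
  by rewrite block_eq // => /andP[xc /eqP->]; exists x; rewrite ?inE.
by move=> [c h] /=; rewrite andbT => c0; apply/imsetP; exists (c, h); rewrite ?inE.
Qed.

(** The first condition excludes the block of roots of unity itself. *)
Definition meet_count (c : F) (N : nat) : nat :=
  #|[set h | ~~ ((c ^+ k == 1) && (h == 0)) && (meet 1 (c ^+ k) h == N)]|.

Lemma meet_count_outside c N : c ^+ q != c ->
  (meet_count c N = (N == 1) * k ^ 2 + (N == 0) * (q ^ 2 - k ^ 2))%N.
Proof.
move=> cK; rewrite -(count_outside N cK); apply: eq_card => h; rewrite !inE.
case: eqP => //= ck.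
by rewrite (unity_in_subfield (expr1n F 2) ck) eqxx in cK.
Qed.

Let sum_const (n : nat) (u : F) (f : F -> nat) m :
  #|[set x : F | x ^+ k == u]| = n ->
  (forall h : F, h ^+ k = u -> f h = m) ->
  (\sum_(h : F | h ^+ k == u) f h = m * n)%N.
Proof.
move=> <- fm; rewrite (eq_bigr (fun _ => m)) => [|h /eqP]; last exact: fm.
by rewrite sum_nat_cond_const mulnC; congr muln; apply: eq_card => x; rewrite !inE.
Qed.

Let sum_const_outside (f : F -> nat) m :
  (forall h : F, h ^+ q != h -> f h = m) ->
  (\sum_(h : F | h ^+ q != h) f h = m * (q ^ 2 - q))%N.
Proof.
move=> fm; rewrite (eq_bigr (fun _ => m)) => [|h]; last exact: fm.
rewrite sum_nat_cond_const mulnC -card_outside_subfield addnK.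
by congr muln; apply: eq_card => x; rewrite !inE.
Qed.

Let class_neq0 (h : F) : h ^+ k = 1 \/ h ^+ k = -1 -> h != 0.
Proof.
by move=> hk; rewrite -expk_eq0; case: hk => ->; rewrite ?oppr_eq0 oner_eq0.
Qed.

Lemma meet_count_square c N : c ^+ k = 1 ->
  (meet_count c N = (N == 0) * (q ^ 2 - q) + (N == k.-1./2) * k + (N == k./2) * k)%N.
Proof.
move=> ck; rewrite /meet_count ck eqxx -sum1dep_card big_mkcond sum_by_class eqxx /=.
rewrite (sum_const card_unity_class (m := N == k.-1./2)) => [|h hk]; last first.
  have [v1 _ _ _] := meet_values h; rewrite v1 // (negPf (class_neq0 (or_introl hk))).
  by rewrite eq_sym; case: eqP.
rewrite (sum_const card_nonsquare (m := N == k./2)) => [|h hk]; last first.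
  have [_ v2 _ _] := meet_values h; rewrite v2 // (negPf (class_neq0 (or_intror hk))).
  by rewrite eq_sym; case: eqP.
rewrite (sum_const_outside (m := N == 0%N)) => [|h hK]; last first.
  have h0 : h != 0 by apply: contraNneq hK => ->; rewrite expr0n.
  by rewrite meet_outside_line ?expr1n // (negPf h0) eq_sym; case: eqP.
lia.
Qed.

Lemma meet_count_nonsquare c N : c ^+ k = -1 ->
  (meet_count c N =
   (N == 0) * (q ^ 2 - q + 1) + (N == k./2) * k + (N == uphalf k) * k)%N.
Proof.
have [w _ N1] := nonsquareP.
move=> ck; rewrite /meet_count ck eq_sym (negPf N1) /= -sum1dep_card big_mkcond sum_by_class.
rewrite (sum_const card_unity_class (m := N == k./2)) => [|h hk]; last first.
  by have [_ _ v1 _] := meet_values h; rewrite v1 // eq_sym; case: eqP.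
rewrite (sum_const card_nonsquare (m := N == uphalf k)) => [|h hk]; last first.
  by have [_ _ _ v2] := meet_values h; rewrite v2 // eq_sym; case: eqP.
rewrite (sum_const_outside (m := N == 0%N)) => [|h hK]; last first.
  by rewrite meet_outside_line ?sqrrN ?expr1n // eq_sym; case: eqP.
rewrite meet_distinct // [0%N == N]eq_sym; case: (N == 0%N); lia.
Qed.

Lemma sum_meet_count N :
  (\sum_(c : F | c != 0%R) meet_count c N =
   (q ^ 2 - q) * ((N == 1) * k ^ 2 + (N == 0) * (q ^ 2 - k ^ 2)) +
   k * ((N == 0) * (2 * q ^ 2 - 2 * q + 1) +
        k * ((N == k.-1./2) + 2 * (N == k./2) + (N == uphalf k))))%N.
Proof.
rewrite big_mkcond sum_by_class eqxx /=.
have n0 (c u : F) : c ^+ k = u -> (u == 1) || (u == -1) -> c != 0.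
  by move=> <- /orP[]/eqP ck; apply: class_neq0; [left | right].
rewrite (sum_const card_unity_class
  (m := (N == 0) * (q ^ 2 - q) + (N == k.-1./2) * k + (N == k./2) * k)%N)
  => [|c ck]; last first.
  by rewrite (n0 c 1) ?eqxx // meet_count_square.
rewrite (sum_const card_nonsquare
  (m := (N == 0) * (q ^ 2 - q + 1) + (N == k./2) * k + (N == uphalf k) * k)%N)
  => [|c ck]; last first.
  by rewrite (n0 c (-1)) ?eqxx ?orbT // meet_count_nonsquare.
rewrite (sum_const_outside
  (m := ((N == 1) * k ^ 2 + (N == 0) * (q ^ 2 - k ^ 2))%N)) => [|c cK]; last first.
  rewrite meet_count_outside // ifT //.
  by apply: contraNneq cK => ->; rewrite expr0n.
have q2 : (q ^ 2 = q * q)%N by rewrite mulnn.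
have : (q <= q * q)%N by apply: leq_pmulr.
rewrite q2; case: (N == 0%N); case: (N == 1%N); case: (N == k.-1./2);
  case: (N == k./2); case: (N == uphalf k) => /=; nia.
Qed.

(** Each of the [(q ^ 2 - 1) * q ^ 2] parameters of a first block contributes
    the same number of parameters of a second one. Dividing the count of ordered
    pairs of parameters by [k * k], as each block has k parameters, and by 2, as
    the pairs are unordered, gives the formula. *)
Lemma multiplicity_blocks N :
  (multiplicity blocks N =
   q ^ 2 * (q + 1) *
   (2 * q * ((N == 1) * k ^ 2 + (N == 0) * (q ^ 2 - k ^ 2)) +
    (N == 0) * (2 * q ^ 2 - 2 * q + 1) +
    k * ((N == k.-1./2) + 2 * (N == k./2) + (N == uphalf k))))%N.
Proof.
have orbit c h : c != 0 ->
  (\sum_(c' : F | c' != 0%R) \sum_h' ((block c h != block c' h')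
      && (#|block c h :&: block c' h'| == N)) = \sum_(c : F | c != 0%R) meet_count c N)%N.
  move=> c0; rewrite (reindex_inj (mulfI c0)) /=.
  apply: eq_big => [c'|c' cc'0]; first by rewrite mulf_eq0 (negPf c0).
  rewrite /meet_count -sum1dep_card [RHS]big_mkcond.
  (* the second block is written as the image of the block of (c', h') under
     x |-> c x + h, which maps the roots of unity to the first block *)
  rewrite (reindex_inj (mulfI c0)) (reindex_inj (@addIr F (h / c))) /=.
  apply: eq_bigr => h' _.
  have -> : c * (h' + h / c) = c * h' + h by field.
  have e1 : (c ^+ k == (c * c') ^+ k) = (c' ^+ k == 1).
    rewrite exprMn eq_sym -[X in _ == X]mulr1 (inj_eq (mulfI _)) ?expk_eq0 //.
  have e2 : (h == c * h' + h) = (h' == 0).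
    by rewrite eq_sym -[X in _ == X]add0r (inj_eq (addIr _)) mulf_eq0 (negPf c0).
  rewrite block_eq // card_block_meet_scaled // addrK.
  by rewrite e1 e2 ![c * _ / c]mulrAC divff // !mul1r; case: ifP.
have E : (k * (k * (2 * multiplicity blocks N)) =
    (q ^ 2 - 1) * q ^ 2 * \sum_(c : F | c != 0%R) meet_count c N)%N.
  rewrite double_multiplicity sum_blocks big_distrr /=.
  under eq_bigr => c c0.
    rewrite big_distrr /=.
    under eq_bigr => h _ do rewrite sum_blocks orbit //.
    rewrite sum_nat_const cardF.
    over.
  rewrite sum_nat_cond_const mulnA; congr (_ * _ * _)%N.
  by rewrite -cardF subn1 -(cardsC1 (0 : F)); apply: eq_card => c; rewrite !inE.
move: E; rewrite sum_meet_count.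
have -> : (q ^ 2 - q = k * (2 * q))%N by rewrite -mulnn /q; nia.
rewrite -[(k * (2 * q) * _)%N]mulnA -mulnDr addnA; set Y := (_ + _ + _)%N.
have -> : (q ^ 2 - 1 = 2 * k * (q + 1))%N by rewrite -mulnn /q; nia.
move=> E; apply/eqP; rewrite -(eqn_pmul2l (_ : 0 < k * k * 2)%N) ?muln_gt0 ?k_gt0 //.
by apply/eqP; rewrite -[LHS]mulnA -[LHS]mulnA E; ring.
Qed.

(** * The design properties *)

(** The ratio [s = (u + d) / u] runs over the roots of unity other than 1, and
    [u = d / (s - 1)] recovers [u] from it. *)
Lemma card_ratio_class (d : F) : d != 0 ->
  #|[set u | (u != 0) && ((u + d) ^+ k == u ^+ k)]| = k.-1.
Proof.
move=> d0; pose S := [set s : F | s ^+ k == 1].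
have <- : #|S :\ 1| = k.-1.
  by have := cardsD1 1 S; rewrite inE expr1n eqxx card_unity_class => ->.
have inj : {in S :\ 1 &, injective (fun s => d / (s - 1))}.
  move=> s t _ _ /(mulfI d0)/invr_inj; exact: addIr.
rewrite -(card_in_imset inj); apply: eq_card => u; rewrite !inE.
apply/andP/imsetP => [[u0 /eqP ud]|[s]].
  have e1 : (u + d) / u - 1 = d / u by field.
  exists ((u + d) / u); last by rewrite e1 invf_div mulrCA divff ?mulr1.
  rewrite !inE expr_div_n ud divff ?expk_eq0 // eqxx andbT.
  by rewrite -subr_eq0 e1 mulf_neq0 ?invr_eq0.
rewrite !inE => /andP[s1 /eqP sk] ->.
have s10 : s - 1 != 0 by rewrite subr_eq0.
rewrite mulf_neq0 ?invr_eq0 //; split=> //.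
have -> : d / (s - 1) + d = s * (d / (s - 1)) by field.
by rewrite exprMn sk mul1r.
Qed.

(** The blocks through [x] and [y] have parameters [(c, x - u)] where [u] and
    [u + (y - x)] have the same power as [c]: there are k - 1 such [u] by
    [card_ratio_class] and k such [c] for each. *)
Lemma two_design_blocks : two_design blocks (q ^ 2) k k.-1.
Proof.
split=> // [B /imsetP[[c h]]|x y xy]; first by rewrite inE => c0 ->; rewrite card_block.
apply/eqP; rewrite -(eqn_pmul2l k_gt0) -sum1dep_card big_mkcondr sum_blocks exchange_big /=.
rewrite (reindex_inj (inv_inj (subKr x))) /=.
have d0 : y - x != 0 by rewrite subr_eq0 eq_sym.
rewrite -(card_ratio_class d0) mulnC -sum_nat_const; apply/eqP; rewrite [RHS]big_mkcond /=.
apply: eq_bigr => u _; rewrite !inE.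
have E c : ((x \in block c (x - u)) && (y \in block c (x - u)))
    = (u ^+ k == c ^+ k) && ((u + (y - x)) ^+ k == u ^+ k).
  rewrite !inE subKr opprB (_ : y + (u - x) = u + (y - x)); last by ring.
  by case: eqP => //= ->.
under eq_bigr => c _ do rewrite E.
rewrite -big_mkcondr /=; case: (_ ^+ k == u ^+ k) => /=; last first.
  by rewrite andbF big_pred0 // => c; rewrite !andbF.
rewrite andbT; case: eqVneq => [->|u0] /=.
  rewrite big_pred0 // => c; rewrite andbT expr0n eqn0Ngt k_gt0 /= [0 == _]eq_sym expk_eq0.
  by case: eqP.
rewrite sum1dep_card -[RHS](card_power_class u0); apply: eq_card => c.
rewrite !inE andbT [_ == c ^+ k]eq_sym.
have [->|//] := eqVneq c 0.
have /eqP-> : (0 : F) ^+ k == 0 by rewrite expk_eq0.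
by rewrite [0 == _]eq_sym expk_eq0 (negPf u0).
Qed.

End PowerClasses.

(** * Cyclotomic classes are level sets *)

Lemma prim_root_neq0 (R : nzRingType) n (z : R) : n.-primitive_root z -> z != 0.
Proof.
move=> prim_z; apply/eqP => z0; have := prim_expr_order prim_z.
move/eqP; rewrite z0 expr0n eqn0Ngt (prim_order_gt0 prim_z).
by rewrite eq_sym oner_eq0.
Qed.

(** The exponent [t] matters modulo [e] exactly when [t * k] matters modulo
    [e * k], the order of [alpha]. *)
Lemma cyclotomic_class_block (F : finFieldType) (alpha : {unit F}) (e k i : nat) :
  (0 < k)%N -> (e * k)%N.-primitive_root (FinRing.uval alpha) ->
  #[alpha]%g = (e * k)%N ->
  cyclotomic_class alpha e i = block k (FinRing.uval alpha ^+ i) 0.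
Proof.
set z := FinRing.uval alpha => k_gt0 prim_z oz.
apply/setP => x; rewrite inE subr0.
have modE t : (z ^+ t ^+ k == z ^+ i ^+ k) = (t == i %[mod e])%N.
  by rewrite -!exprM (eq_prim_root_expr prim_z) -!muln_modl eqn_pmul2r.
apply/imsetP/idP => [[t]|/eqP xk]; first by rewrite inE => ti ->; rewrite modE.
have : x ^+ (e * k) = 1.
  rewrite mulnC exprM xk -!exprM (_ : i * (k * e) = e * k * i)%N; last by lia.
  by rewrite exprM (prim_expr_order prim_z) expr1n.
case/(prim_rootP prim_z) => t xt; have t_lt : (t < #[alpha]%g)%N by rewrite oz.
by exists (Ordinal t_lt); rewrite // inE -modE -xt xk.
Qed.

Section Translates.

Variables (F : finFieldType) (k e : nat) (alpha : {unit F}).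
Hypothesis k_gt0 : (0 < k)%N.
Let z := FinRing.uval alpha.
Hypothesis cardF : #|F| = (e.+1 * k).+1.
Hypothesis prim_z : (e.+1 * k)%N.-primitive_root z.
Variable C : 'I_e.+1 -> {set F}.
Hypothesis C_E : forall i, C i = block k (z ^+ i) 0.

Lemma power_class_cover (x : F) : x != 0 ->
  exists2 i : 'I_e.+1, x ^+ k = (z ^+ i) ^+ k
    & forall j : 'I_e.+1, (z ^+ i) ^+ k = (z ^+ j) ^+ k -> i = j.
Proof.
move=> x0; have : x ^+ (e.+1 * k) = 1.
  by apply: (mulfI x0); rewrite -exprS -cardF expf_card mulr1.
case/(prim_rootP prim_z) => t xt.
exists (inord (t %% e.+1)).
  rewrite xt inordK ?ltn_pmod // -!exprM; apply/eqP.
  by rewrite (eq_prim_root_expr prim_z) -!muln_modl modn_mod.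
move=> j /eqP; rewrite -!exprM (eq_prim_root_expr prim_z) -!muln_modl eqn_pmul2r //.
rewrite inordK ?ltn_pmod // modn_mod (modn_small (ltn_ord j)) => /eqP tj.
by apply: val_inj; rewrite /= inordK ?ltn_pmod.
Qed.

Lemma dev_block : dev C = blocks F k.
Proof.
have trans (i : 'I_e.+1) g : [set x + g | x in C i] = block k (z ^+ i) g.
  apply/setP => x; rewrite C_E inE; apply/imsetP/idP => [[y]|xB].
    by rewrite inE subr0 => yB ->; rewrite addrK.
  by exists (x - g); rewrite ?subrK // inE subr0.
have z0 : z != 0 := prim_root_neq0 prim_z.
apply/setP => B; apply/imset2P/imsetP => [[i g _ _ ->]|[[c h]]].
  by exists (z ^+ i, g); rewrite ?trans // inE expf_neq0.
rewrite inE /= => c0 ->; have [i ci _] := power_class_cover c0.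
by exists i h; rewrite ?inE // trans; apply/setP => x; rewrite !inE ci.
Qed.

(** The classes partition the nonzero elements, so summing over them leaves one
    condition on the smaller point [u] of a pair [(u + d, u)]: that both have
    the same k-th power. *)
Lemma sum_differences (d : F) :
  (\sum_i #|[set xy in setX (C i) (C i) | (xy.1 - xy.2)%R == d]| =
   #|[set u : F | (u != 0%R) && ((u + d) ^+ k == u ^+ k)]|)%N.
Proof.
transitivity (\sum_(i < e.+1) \sum_(u : F)
  ((u ^+ k == (z ^+ i) ^+ k) && ((u + d) ^+ k == u ^+ k)))%N.
  apply: eq_bigr => i _; rewrite -big_mkcond /= sum1dep_card.
  have inj : injective (fun u : F => (u + d, u)) by move=> u v [].
  rewrite -[RHS](card_imset _ inj); apply: eq_card => -[x y].
  rewrite !inE C_E !inE !subr0 /=; apply/andP/imsetP => [[/andP[xi yi] /eqP <-]|[u]].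
    by exists y; rewrite ?inE ?(eqP yi) subrKC ?xi ?eqxx.
  by rewrite inE => /andP[/eqP ui /eqP ud] [-> ->]; rewrite ud ui eqxx addrAC subrr add0r.
rewrite exchange_big -sum1dep_card [RHS]big_mkcond; apply: eq_bigr => u _ /=.
have z0 : z != 0 := prim_root_neq0 prim_z.
have [->|u0] /= := eqVneq u 0.
  rewrite big1 // => i _; rewrite expr0n eqn0Ngt k_gt0 eq_sym.
  by rewrite !expf_eq0 (negPf z0) !andbF.
have [i ui uniq_i] := power_class_cover u0.
rewrite (bigD1 i) //= ui eqxx big1 ?addn0 // => j ji.
by case: eqP => // /uniq_i ij; rewrite ij eqxx in ji.
Qed.

End Translates.
(** * The intersection table *)

(** Completeness of the table needs no separate argument: for a number in no
    row the sum is empty, so its multiplicity vanishes. *)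
Lemma intersection_tableP (T : finType) (D : {set {set T}}) (tab : seq (rat * rat)) :
  (forall N, (multiplicity D N)%:R = \sum_(row <- tab | row.1 == N%:R) row.2) ->
  (forall a, a \in [seq row.1 | row <- tab] ->
     exists2 N, a = N%:R & (0 < multiplicity D N)%N) ->
  has_intersection_table D tab.
Proof.
move=> multE tab_pos; split=> [a|N _]; last exact: multE.
split=> [/tab_pos[N -> /block_intersection_numberE]|[N -> /block_intersection_numberE mN]].
  by exists N.
apply/negP => N_tab; move: (multE N).
rewrite big_seq_cond big_pred0 => [/eqP|row]; first by rewrite pnatr_eq0 eqn0Ngt mN.
apply/andP => -[row_tab /eqP rowN]; case: N_tab.
by rewrite -rowN map_f.
Qed.

Lemma four_row_sum (a b c d u v w x n : rat) :
  \sum_(row <- [:: (a, u); (b, v); (c, w); (d, x)] | row.1 == n) row.2 =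
  (a == n)%:R * u + (b == n)%:R * v + (c == n)%:R * w + (d == n)%:R * x.
Proof.
rewrite !big_cons big_nil /=.
by do 4!case: ifP => _; rewrite ?mul1r ?mul0r ?addr0 ?add0r ?addrA.
Qed.

Theorem theorem4p5 (p r : nat) (F : finFieldType) (alpha : {unit F})
    (p_prime : prime p) (p_odd : odd p) (r_gt0 : (0 < r)%N)
    (pr_ge5 : (5 <= p ^ r)%N)
    (cardF : #|F| = (p ^ (2 * r))%N)
    (alpha_gen : generator [set: {unit F}] alpha) :
  [/\ difference_family (@CH p r F alpha)
        (p ^ (2 * r)) ((p ^ r - 1) %/ 2) ((p ^ r - 3) %/ 2),
      two_design (dev (@CH p r F alpha))
        (p ^ (2 * r)) ((p ^ r - 1) %/ 2) ((p ^ r - 3) %/ 2),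
      (p ^ r - 1 = 0 %[mod 4])%N ->
        has_intersection_table (dev (@CH p r F alpha))
          [:: (0,
               (3 * p%:R ^+ (6 * r) + 9 * p%:R ^+ (5 * r) + p%:R ^+ (4 * r)
                - 3 * p%:R ^+ (3 * r) + 2 * p%:R ^+ (2 * r)) / 2);
              (1,
               (p%:R ^+ (6 * r) - p%:R ^+ (5 * r) - p%:R ^+ (4 * r)
                + p%:R ^+ (3 * r)) / 2);
              ((p%:R ^+ r - 5) / 4,
               (p%:R ^+ (4 * r) - p%:R ^+ (2 * r)) / 2);
              ((p%:R ^+ r - 1) / 4,
               (3 * p%:R ^+ (4 * r) - 3 * p%:R ^+ (2 * r)) / 2)]
    & (p ^ r - 1 = 2 %[mod 4])%N ->
        has_intersection_table (dev (@CH p r F alpha))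
          [:: (0,
               (3 * p%:R ^+ (6 * r) + 9 * p%:R ^+ (5 * r) + p%:R ^+ (4 * r)
                - 3 * p%:R ^+ (3 * r) + 2 * p%:R ^+ (2 * r)) / 2);
              (1,
               (p%:R ^+ (6 * r) - p%:R ^+ (5 * r) - p%:R ^+ (4 * r)
                + p%:R ^+ (3 * r)) / 2);
              ((p%:R ^+ r - 3) / 4,
               (3 * p%:R ^+ (4 * r) - 3 * p%:R ^+ (2 * r)) / 2);
              ((p%:R ^+ r + 1) / 4,
               (p%:R ^+ (4 * r) - p%:R ^+ (2 * r)) / 2)]].
Proof.
pose k := (p ^ r)./2.
have qE : (p ^ r = k.*2.+1)%N by rewrite -[LHS]odd_double_half oddX p_odd orbT.
have k_ge2 : (2 <= k)%N by rewrite qE in pr_ge5; lia.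
have k_gt0 : (0 < k)%N by apply: leq_trans k_ge2.
have cardF2 : #|F| = (k.*2.+1 ^ 2)%N by rewrite cardF mulnC expnM qE.
have oalpha : #[alpha]%g = (2 * (k.*2.+1 + 1) * k)%N.
  rewrite orderE -(eqP alpha_gen) card_finField_unit cardF2 -mulnn; lia.
have prim_z : (2 * (k.*2.+1 + 1) * k)%N.-primitive_root (FinRing.uval alpha).
  rewrite -oalpha; apply/andP; split; first exact: order_gt0.
  apply/forallP => i; rewrite unity_rootE -FinRing.val_unitX -FinRing.val_unit1.
  rewrite (inj_eq val_inj) -order_dvdn; apply/eqP; apply/idP/eqP => [|->//].
  by move/dvdn_leq => le; apply/eqP; rewrite eqn_leq ltn_ord le.
have qsub (x y : F) : (x - y) ^+ k.*2.+1 = x ^+ k.*2.+1 - y ^+ k.*2.+1.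
  have pF := card_finPcharP cardF p_prime.
  have pq : [pchar F].-nat k.*2.+1.
    by rewrite -qE pnatX pnatE // pF.
  rewrite exprDn_pchar // exprNn -signr_odd /= odd_double /=.
  by rewrite expr1 mulN1r.
have C_E i : @CH p r F alpha i = block k (FinRing.uval alpha ^+ i) 0.
  by apply: cyclotomic_class_block => //; rewrite qE.
have eE : (2 * (k.*2.+1 + 1) = (2 * p ^ r + 1).+1)%N by rewrite qE; lia.
have prim_z' := prim_z; rewrite eE in prim_z'.
have cardF' : #|F| = ((2 * p ^ r + 1).+1 * k).+1.
  by rewrite -eE cardF2 -mulnn; nia.
have devE : dev (@CH p r F alpha) = blocks F k.
  exact: (dev_block k_gt0 cardF' prim_z' C_E).
have k1E : ((p ^ r - 3) %/ 2 = k.-1)%N by rewrite qE; lia.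
have kE : ((p ^ r - 1) %/ 2 = k)%N by rewrite qE; lia.
have vE : (p ^ (2 * r) = k.*2.+1 ^ 2)%N by rewrite -cardF.
have multE := multiplicity_blocks k_ge2 cardF2 prim_z qsub.
have QE : p%:R ^+ r = 2 * k%:R + 1 :> rat.
  by rewrite -natrX qE -muln2 -addn1 natrD natrM mulrC.
have multQ N : (multiplicity (blocks F k) N)%:R =
   (2 * k%:R + 1) ^+ 2 * (2 * k%:R + 2) *
   (2 * (2 * k%:R + 1) * ((1%N == N)%:R * k%:R ^+ 2
       + (0%N == N)%:R * ((2 * k%:R + 1) ^+ 2 - k%:R ^+ 2)) +
    (0%N == N)%:R * (2 * (2 * k%:R + 1) ^+ 2 - 2 * (2 * k%:R + 1) + 1) +
    k%:R * ((k.-1./2 == N)%:R + 2 * (k./2 == N)%:R + (uphalf k == N)%:R)) :> rat.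
  rewrite multE ![_ == N]eq_sym.
  have qR : (k.*2.+1)%:R = 2 * k%:R + 1 :> rat by rewrite -qE natrX QE.
  (* the truncated subtractions are removed before casting to rat *)
  have -> : (k.*2.+1 ^ 2 - k ^ 2 = 3 * k ^ 2 + 4 * k + 1)%N by rewrite -!mulnn; nia.
  have -> : (2 * k.*2.+1 ^ 2 - 2 * k.*2.+1 + 1 = 8 * k ^ 2 + 4 * k + 1)%N.
    by rewrite -!mulnn; nia.
  by rewrite !(natrM, natrD, natrX) qR; ring.
have PE n : p%:R ^+ (n * r) = (2 * k%:R + 1) ^+ n :> rat by rewrite mulnC exprM QE.
have natr_eq0' N : (0 == N%:R :> rat) = (0%N == N) by rewrite -(eqr_nat rat).
have natr_eq1' N : (1 == N%:R :> rat) = (1%N == N) by rewrite -(eqr_nat rat).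
have mult0 : (0 < multiplicity (blocks F k) 0)%N by rewrite multE !(addn_gt0, muln_gt0, expn_gt0, k_gt0, eqxx, orbT).
have mult1 : (0 < multiplicity (blocks F k) 1)%N by rewrite multE !(addn_gt0, muln_gt0, expn_gt0, k_gt0, eqxx, orbT).
have multM : (0 < multiplicity (blocks F k) k./2)%N.
  by rewrite multE !(addn_gt0, muln_gt0, expn_gt0, k_gt0, eqxx, orbT).
split.
- rewrite k1E kE; split; first by [].
    by move=> i; rewrite C_E (card_block k_ge2 prim_z) ?expf_neq0 ?(prim_root_neq0 prim_z).
  move=> d d0; rewrite (sum_differences k_gt0 cardF' prim_z' C_E).
  exact: (card_ratio_class k_ge2 prim_z).
- rewrite devE k1E kE vE; exact: (two_design_blocks k_ge2 cardF2 prim_z qsub).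
- move=> mod4; have k_even : ~~ odd k by move: mod4; rewrite qE; lia.
  have KE : k%:R = 2 * (k./2)%:R :> rat by rewrite -natrM; congr _%:R; lia.
  have row3 : (p%:R ^+ r - 5) / 4 = (k.-1./2)%:R :> rat.
    by rewrite QE KE (_ : k./2 = (k.-1./2).+1); [rewrite -natr1; field | lia].
  have row4 : (p%:R ^+ r - 1) / 4 = (k./2)%:R :> rat by rewrite QE KE; field.
  rewrite devE; apply: intersection_tableP => [N|a].
    rewrite four_row_sum multQ row3 row4 !PE natr_eq0' natr_eq1' !eqr_nat.
    rewrite (_ : uphalf k = k./2); last by lia.
    by field.
  rewrite !inE row3 row4 => /or4P[]/eqP->; first by exists 0%N.
  - by exists 1%N.
  - by exists k.-1./2 => //; rewrite multE !(addn_gt0, muln_gt0, expn_gt0, k_gt0, eqxx, orbT).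
  by exists k./2.
move=> mod4; have k_odd : odd k by move: mod4; rewrite qE; lia.
have KE : k%:R = 2 * (k./2)%:R + 1 :> rat by rewrite -natrM natr1; congr _%:R; lia.
have row3 : (p%:R ^+ r - 3) / 4 = (k./2)%:R :> rat by rewrite QE KE; field.
have row4 : (p%:R ^+ r + 1) / 4 = (uphalf k)%:R :> rat.
  by rewrite QE KE (_ : uphalf k = (k./2).+1); [rewrite -natr1; field | lia].
rewrite devE; apply: intersection_tableP => [N|a].
  rewrite four_row_sum multQ row3 row4 !PE natr_eq0' natr_eq1' !eqr_nat.
  rewrite (_ : k.-1./2 = k./2); last by lia.
  by field.
rewrite !inE row3 row4 => /or4P[]/eqP->; first by exists 0%N.
- by exists 1%N.
- by exists k./2.
by exists (uphalf k) => //; rewrite multE !(addn_gt0, muln_gt0, expn_gt0, k_gt0, eqxx, orbT).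
Qed.
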